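(* Let $\epsilon>0$ be fixed and for each positive integer $n$ let $t=\left\lceil\frac{2}{\epsilon}(n+3)\right\rceil$. Then at least $\Omega(n^2)$ bits are needed to store a set $\{m_j : j=1,\dots,t\}$ of $t$ integers $m_j\in[0,2^n-1]$ without pre-knowledge of the set. That is, there exist a constant $c>0$ and an integer $n_0$ (depending only on $\epsilon$) such that for every $n\ge n_0$ and every integer $b\ge 0$, if there is an injective map from the collection of all $t$-element subsets of $\{0,1,\dots,2^n-1\}$ to $\{0,1\}^b$, then $b\ge c\,n^2$.
   Context: ''Storing a set without pre-knowledge of the set using $b$ bits'' means having an encoding of all possible $t$-element subsets of $\{0,1,\dots,2^n-1\}$ by bit strings of length $b$ from which the subset can be recovered, i.e. an injective encoding. *)

(* Defs.v *)
From HB Require Import structures.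
From mathcomp Require Import all_boot all_order all_algebra archimedean.
From mathcomp Require Import reals.

Set Implicit Arguments.
Unset Strict Implicit.
Unset Printing Implicit Defensive.

Import Order.TTheory GRing.Theory Num.Theory.

Local Open Scope ring_scope.

(* The ceiling is an [int]; the absolute value, harmless for [0 < eps], turns
   it into a [nat]. *)
Definition set_size (R : realType) (eps : R) (n : nat) : nat :=
  `|Num.ceil (2 / eps * (n + 3)%:R)|%N.

(* When [2 ^ n < t] this type is empty. *)
Definition tsubset (n t : nat) : Type :=
  {A : {set 'I_(2 ^ n)} | #|A| == t}.

Definition storable (n t b : nat) : Prop :=
  exists enc : tsubset n t -> b.-tuple bool, injective enc.

(* Main.v *)
Require Import Defs.
From mathcomp Require Import all_boot all_order all_algebra archimedean.
From mathcomp Require Import reals.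
From mathcomp Require Import zify ring.
Import Order.TTheory GRing.Theory Num.Theory.
Local Open Scope ring_scope.

(** Counting gives [C(2^n, t) <= 2^b], and [C(N, t) >= (N / t)^t]. As [t] is
    linear in [n], eventually [t <= 2^(n/2)], so [b >= (n/2) t], which is
    quadratic in [n]. *)

(** The set size [t] is bounded on both sides, for opposite purposes. The upper bound [set_size_le]
    and [leq_linear_exp_half] keep [t] below 2^(n/2), so [storable_leq_half] can combine the
    counting bound [storable_bin] with [leq_exp_bin]. The lower bound [set_size_ge] then makes the
    resulting (n/2) t quadratic. *)

(** Induction on (t+1) C(N, t+1) = N C(N-1, t): since N >= a (t+1), each step gains a factor N /
    (t+1) >= a. *)
Lemma leq_exp_bin (a N t : nat) : (a * t <= N -> a ^ t <= 'C(N, t))%N.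
Proof.
elim: t N => [|t IHt] N leN; first by rewrite bin0.
case: a leN IHt => [|a] leN IHt; first by rewrite exp0n.
have leN1 : (a.+1 * t <= N.-1)%N by nia.
rewrite -(leq_pmul2l (ltn0Sn t)) -mul_bin_diag expnS mulnA (mulnC t.+1).
exact: leq_mul (IHt _ leN1).
Qed.

Lemma storable_bin (n t b : nat) : storable n t b -> ('C(2 ^ n, t) <= 2 ^ b)%N.
Proof.
case=> enc enc_inj; have := leq_card enc enc_inj.
have := card_draws 'I_(2 ^ n) t; rewrite card_ord cardsE => <-.
by rewrite card_tuple card_bool card_sig.
Qed.

(** With k = floor(n/4), 2^(n/2) splits into two factors 2^k >= k+1: one absorbs [K], as 6K <= k,
    the other n+3, as n+3 <= 6(k+1). *)
Lemma leq_linear_exp_half (K n : nat) :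
  (24 * K <= n -> K * (n + 3) <= 2 ^ n./2)%N.
Proof.
move=> len; set k := (n./2./2)%N.
have ltk : (k < 2 ^ k)%N := ltn_expl k (ltnSn 1).
have lek : (6 * K <= k)%N by rewrite /k; lia.
have len3 : (n + 3 <= 6 * k.+1)%N by rewrite /k; lia.
have le_sq : (k.+1 * k.+1 <= 2 ^ n./2)%N.
  apply: leq_trans (leq_mul ltk ltk) _.
  by rewrite -expnD leq_exp2l // /k; lia.
by apply: leq_trans le_sq; nia.
Qed.

Lemma storable_leq_half (n t b : nat) :
  (t <= 2 ^ n./2)%N -> storable n t b -> (n./2 * t <= b)%N.
Proof.
move=> let_ /storable_bin le_bin.
rewrite -(leq_exp2l _ _ (ltnSn 1)) expnM; apply: leq_trans le_bin.
(* Here [a] is 2^(n/2), and a t <= a^2 <= 2^n. *)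
apply: leq_exp_bin; apply: leq_trans (leq_mul (leqnn _) let_) _.
by rewrite -expnD leq_exp2l //; lia.
Qed.

Lemma set_size_ge (R : realType) (eps : R) (n : nat) :
  0 < eps -> 2 / eps * (n + 3)%:R <= (set_size eps n)%:R.
Proof.
move=> eps_gt0; have x_ge0 : 0 <= 2 / eps * (n + 3)%:R.
  by rewrite mulr_ge0 ?divr_ge0 ?ler0n // ltW.
rewrite /set_size natr_absz ger0_norm ?ceil_ge // -(ler_int R).
exact: le_trans x_ge0 (ceil_ge _).
Qed.

Lemma set_size_le (R : realType) (eps : R) (K n : nat) :
  0 < eps -> 2 / eps <= K%:R -> (set_size eps n <= K * (n + 3))%N.
Proof.
move=> eps_gt0 leK; have x_ge0 : 0 <= 2 / eps * (n + 3)%:R.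
  by rewrite mulr_ge0 ?divr_ge0 ?ler0n // ltW.
have c_ge0 : 0 <= Num.ceil (2 / eps * (n + 3)%:R).
  by rewrite -(ler_int R); exact: le_trans x_ge0 (ceil_ge _).
rewrite -lez_nat /set_size gez0_abs // ceil_le_int.
by rewrite -[_%:~R]/((K * (n + 3))%:R) natrM ler_wpM2r.
Qed.

Theorem theorem7 (R : realType) (eps : R) (eps_gt0 : 0 < eps) :
  exists (c : R) (n0 : nat), 0 < c /\
    forall n : nat, (0 < n)%N -> (n0 <= n)%N ->
    forall b : nat, storable n (set_size eps n) b ->
      c * n%:R ^+ 2 <= b%:R.
Proof.
pose K := `|Num.ceil (2 / eps)|%N.
have leK : 2 / eps <= K%:R.
  by rewrite natr_absz; apply: le_trans (ceil_ge _) _; rewrite ler_int ler_norm.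
(* The factor 2 in 2/eps cancels the half in n/2, leaving 1/eps. The summand 2 gives n >= 2, needed
   at the end. *)
exists eps^-1, (24 * K + 2)%N; split=> [|n _ le_n b stor]; first by rewrite invr_gt0.
have leb : (n./2 * set_size eps n <= b)%N.
  apply: storable_leq_half stor.
  by apply: leq_trans (set_size_le _ _ _ n eps_gt0 leK) (leq_linear_exp_half _ _ _); lia.
have leb_R : n./2%:R * (set_size eps n)%:R <= b%:R :> R by rewrite -natrM ler_nat.
apply: le_trans leb_R.
apply: le_trans (ler_wpM2l (ler0n _ _) (set_size_ge _ _ n eps_gt0)).
have -> : n./2%:R * (2 / eps * (n + 3)%:R) = eps^-1 * (2 * n./2 * (n + 3))%:R :> R.
  by rewrite !natrM; ring.
rewrite ler_pM2l ?invr_gt0 // -natrX ler_nat.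
(* Rounding n/2 down costs at most 1, and (n-1)(n+3) = n^2 + 2n - 3 >= n^2 once n >= 2. *)
have : (n <= (2 * n./2).+1)%N by lia.
nia.
Qed.
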